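(* $\alpha$-equivalence of ultimately periodic bar strings, represented as pairs of finite words, is decidable in polynomial time: there is a polynomial-time algorithm that, given pairs $(u_0,v_0),(u_1,v_1)\in\overline{\mathbb A}^*\times\overline{\mathbb A}^+$, decides whether $u_0v_0^\omega\equiv_\alpha u_1v_1^\omega$.
   Context: $\mathbb A$ is a fixed countably infinite set of names; $\overline{\mathbb A}=\mathbb A\cup\{\vert a : a\in\mathbb A\}$, where $a$ is a plain name and $\vert a$ a bar name. A bar string is a finite word over $\overline{\mathbb A}$; an infinite bar string is an element of $\overline{\mathbb A}^\omega$. Finite permutations $\pi$ of $\mathbb A$ act by $\pi\cdot a=\pi(a)$, $\pi\cdot\vert a=\vert\pi(a)$, and letterwise on words; $(a\ c)$ is the transposition of $a$ and $c$. For finite bar strings $v,u$ write $\langle a\rangle v=\langle b\rangle u$ iff $(a\ c)\cdot v=(b\ c)\cdot u$ for some (equivalently every) name $c\notin\{a,b\}$ not occurring (plain or barred) in $v$ or $u$. $\alpha$-equivalence $\equiv_\alpha$ on finite bar strings is the equivalence relation generated by $w\vert a\,v\equiv_\alpha w\vert b\,u$ whenever $\langle a\rangle v=\langle b\rangle u$. Two infinite bar strings are $\alpha$-equivalent iff for every $n\in\mathbb N$ their prefixes of length $n$ are $\alpha$-equivalent. *)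

(* Defs.v *)
From HB Require Import structures.
From Stdlib Require Import Relations.
From mathcomp Require Import all_boot all_order all_algebra.

Set Implicit Arguments.
Unset Strict Implicit.
Unset Printing Implicit Defensive.

Inductive letter (A : Type) : Type :=
  | Plain of A
  | Bar of A.

Definition letter_name (A : Type) (x : letter A) : A :=
  match x with Plain a => a | Bar a => a end.

Definition letter_map (A : Type) (f : A -> A) (x : letter A) : letter A :=
  match x with Plain a => Plain (f a) | Bar a => Bar (f a) end.

Definition bar_string (A : Type) : Type := seq (letter A).

Definition inf_bar_string (A : Type) : Type := nat -> letter A.

Definition names (A : Type) (w : bar_string A) : seq A :=
  map (@letter_name A) w.

Definition transp (A : eqType) (a c x : A) : A :=
  if x == a then c else if x == c then a else x.

Definition transp_act (A : eqType) (a c : A) (w : bar_string A) :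
    bar_string A :=
  map (letter_map (transp a c)) w.

(* <a>v = <b>u *)
Definition abs_eq (A : eqType) (a : A) (v : bar_string A)
    (b : A) (u : bar_string A) : Prop :=
  exists c : A, [/\ c \notin [:: a; b], c \notin names v, c \notin names u
                  & transp_act a c v = transp_act b c u].

Inductive alpha_step (A : eqType) : bar_string A -> bar_string A -> Prop :=
  | AlphaStep (w : bar_string A) (a : A) (v : bar_string A)
      (b : A) (u : bar_string A) :
      abs_eq a v b u -> alpha_step (w ++ Bar a :: v) (w ++ Bar b :: u).

Definition alpha_eq (A : eqType) : bar_string A -> bar_string A -> Prop :=
  clos_refl_sym_trans (bar_string A) (@alpha_step A).

Definition alpha_eq_inf (A : eqType) (x y : inf_bar_string A) : Prop :=
  forall n : nat, alpha_eq (mkseq x n) (mkseq y n).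

(* A pair (u, v) with v nonempty; v is given by its first letter and the rest,
   so that every such record is a legitimate representation. *)
Record up_pair (A : Type) : Type := UpPair {
  up_u : bar_string A;
  up_vhead : letter A;
  up_vtail : bar_string A
}.

Definition up_v (A : Type) (p : up_pair A) : bar_string A :=
  up_vhead p :: up_vtail p.

(* The infinite word u v^omega; the default value of nth is never reached. *)
Definition up_word (A : Type) (p : up_pair A) : inf_bar_string A :=
  fun n =>
    if n < size (up_u p) then nth (up_vhead p) (up_u p) n
    else nth (up_vhead p) (up_v p) ((n - size (up_u p)) %% size (up_v p)).

Inductive move : Type := MoveLeft | Stay | MoveRight.

(* Tape cells hold [None] (blank), [Some (inl s)] (input symbol) or
   [Some (inr g)] (auxiliary work symbol). Tape number 0 is the input tape.
   The machine has halted, with answer [b],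
   exactly when [tm_answer] of the current state is [Some b]. *)
Record tm (Sigma : finType) : Type := TM {
  tm_ntapes_pred : nat;
  tm_work : finType;
  tm_state : finType;
  tm_start : tm_state;
  tm_answer : tm_state -> option bool;
  tm_trans : tm_state ->
    {ffun 'I_tm_ntapes_pred.+1 -> option (Sigma + tm_work)} ->
    tm_state * ('I_tm_ntapes_pred.+1 -> option (Sigma + tm_work) * move)
}.

(* A tape, infinite in both directions and blank almost everywhere: the cells
   left of the head, nearest first, and the cells from the head rightwards;
   all cells beyond the two lists are blank. *)
Record tape (S : Type) : Type := Tape {
  tape_left : seq (option S);
  tape_right : seq (option S)
}.

Definition tape_read (S : Type) (t : tape S) : option S :=
  head None (tape_right t).

Definition tape_act (S : Type) (t : tape S) (a : option S * move) : tape S :=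
  let: Tape l r := t in
  match a.2 with
  | MoveLeft => Tape (behead l) (head None l :: a.1 :: behead r)
  | Stay => Tape l (a.1 :: behead r)
  | MoveRight => Tape (a.1 :: l) (behead r)
  end.

Record tm_config (Sigma : finType) (M : tm Sigma) : Type := TMConfig {
  cfg_state : tm_state M;
  cfg_tape : 'I_(tm_ntapes_pred M).+1 -> tape (Sigma + tm_work M)
}.

Definition tm_init (Sigma : finType) (M : tm Sigma) (w : seq Sigma) :
    tm_config M :=
  TMConfig (tm_start M)
    (fun i => Tape [::] (if i == ord0 then [seq Some (inl s) | s <- w]
                         else [::])).

(* Halted configurations are fixed points. *)
Definition tm_step (Sigma : finType) (M : tm Sigma) (c : tm_config M) :
    tm_config M :=
  if tm_answer (cfg_state c) is Some _ then c
  else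
    let: (q, act) :=
      tm_trans (cfg_state c) [ffun i => tape_read (cfg_tape c i)] in
    TMConfig q (fun i => tape_act (cfg_tape c i) (act i)).

Definition tm_answers_within (Sigma : finType) (M : tm Sigma)
    (w : seq Sigma) (t : nat) (b : bool) : Prop :=
  tm_answer (cfg_state (iter t (@tm_step Sigma M) (tm_init M w))) = Some b.

(* [enc x] is the input word presenting the instance [x]; time is measured
   in the length of that word. *)
Definition decidable_in_polynomial_time (I : Type) (Sigma : finType)
    (enc : I -> seq Sigma) (P : I -> Prop) : Prop :=
  exists (M : tm Sigma) (p : {poly nat}),
    forall x : I, exists b : bool,
      tm_answers_within M (enc x) (p.[size (enc x)])%R b /\ (b <-> P x).

(* [Mark false] starts a plain letter, [Mark true] a bar letter; each is
   followed by the bits of the name. [Sep] separates the four words. *)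
Inductive input_symbol : Type :=
  | Bit of bool
  | Mark of bool
  | Sep.

Definition input_symbol_code (s : input_symbol) : bool + option bool :=
  match s with
  | Bit b => inl b
  | Mark b => inr (Some b)
  | Sep => inr None
  end.

Definition input_symbol_decode (s : bool + option bool) : input_symbol :=
  match s with
  | inl b => Bit b
  | inr (Some b) => Mark b
  | inr None => Sep
  end.

Lemma input_symbol_codeK : cancel input_symbol_code input_symbol_decode.
Proof. by case. Qed.

HB.instance Definition _ :=
  Finite.copy input_symbol (can_type input_symbol_codeK).

(* [nenc] represents names by bit strings. *)
Definition enc_letter (A : Type) (nenc : A -> seq bool) (x : letter A) :
    seq input_symbol :=
  Mark (if x is Bar _ then true else false)
    :: [seq Bit b | b <- nenc (letter_name x)].

Definition enc_bar_string (A : Type) (nenc : A -> seq bool)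
    (w : bar_string A) : seq input_symbol :=
  flatten [seq enc_letter nenc x | x <- w].

Definition enc_up_pair (A : Type) (nenc : A -> seq bool) (p : up_pair A) :
    seq input_symbol :=
  enc_bar_string nenc (up_u p) ++ Sep :: enc_bar_string nenc (up_v p).

Definition enc_up_pairs (A : Type) (nenc : A -> seq bool)
    (x : up_pair A * up_pair A) : seq input_symbol :=
  enc_up_pair nenc x.1 ++ Sep :: enc_up_pair nenc x.2.

(* Main.v *)
(** Replace every letter of a bar string by the distance back to the last bar
    letter with the same name (distance 0 for a bar letter), or by the name
    itself if there is none.  Two bar strings are alpha-equivalent iff these
    code words coincide, because an alpha-step does not change the code and
    bound names can be made equal from left to right.

    For an ultimately periodic word the code at position i + P is determined by
    the code at position i once i is past the initial parts and one period,
    where P is a common period: a binder inside the periodic part moves along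
    with i, one in the initial part stays in place.  Hence comparing the first
    |u0| + |u1| + |v0| + |v1| + |v0| |v1| positions suffices, which a multi-tape
    machine does letter by letter, walking back jointly over the two prefixes
    read so far until it meets a binder of one of the two current names. *)

From Stdlib Require Import Relations.
Require Import Defs.
From mathcomp Require Import all_boot all_algebra zify.

Set Implicit Arguments.
Unset Strict Implicit.
Unset Printing Implicit Defensive.

(** * Alpha-equivalence through binder distances *)

Section AlphaEquivalence.
Variable A : eqType.
Implicit Types (a b c : A) (l : letter A) (w x y u v p : bar_string A).

Definition binds a l : bool := if l is Bar b then b == a else false.

Definition code a p : nat + A :=
  if has (binds a) p then inl (find (binds a) p) else inr a.

(** [p] lists the letters before [w], latest first. The current letter goes on top before the
    search, so only bar letters get distance 0. *)
Fixpoint codes p w : seq (nat + A) :=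
  if w is l :: w' then code (letter_name l) (l :: p) :: codes (l :: p) w'
  else [::].

Lemma codes_cat p w x : codes p (w ++ x) = codes p w ++ codes (rev w ++ p) x.
Proof.
elim: w p => [|l w IHw] p //=.
by rewrite IHw rev_cons cat_rcons.
Qed.

Lemma size_codes p w : size (codes p w) = size w.
Proof. by elim: w p => //= l w IHw p; rewrite IHw. Qed.

Lemma transp_inj a c : injective (transp a c).
Proof.
move=> x y; rewrite /transp.
case: (x =P a) => [->|xa]; case: (y =P a) => [->|ya] //;
  case: (x =P c) => [xc|xc]; case: (y =P c) => [yc|yc] //; congruence.
Qed.

Lemma binds_transp a c b l :
  binds (transp a c b) (letter_map (transp a c) l) = binds b l.
Proof. by case: l => //= d; rewrite (inj_eq (@transp_inj a c)). Qed.

Lemma transp_fix a c b : b != a -> b != c -> transp a c b = b.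
Proof. by rewrite /transp => /negbTE-> /negbTE->. Qed.

Lemma transpL a c : transp a c a = c.
Proof. by rewrite /transp eqxx. Qed.

(** Hits in [r] persist because the transposition is injective. The search for [a] stops at [Bar a]
    at the latest and never reaches [p]; any other [b] is fixed, and [b != c] prevents capture by
    the new binder. *)
Lemma code_transp a c b (r p : bar_string A) : a != c -> b != c ->
  code b (r ++ Bar a :: p)
  = code (transp a c b) (transp_act a c r ++ Bar c :: p).
Proof.
move=> ac bc; rewrite /code /transp_act !has_cat !find_cat !has_map !find_map.
rewrite !size_map.
have E : preim (letter_map (transp a c)) (binds (transp a c b)) =1 binds b.
  by move=> l; rewrite /= binds_transp.
rewrite (eq_has E) (eq_find E) /=; case: (has _ r) => //=.
case: (eqVneq b a) => [->|ba]; first by rewrite transpL !eqxx.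
rewrite transp_fix // (negbTE (_ : c != b)) ?(eq_sym c) //.
Qed.

Lemma codes_transp a c (r p v : bar_string A) : a != c -> c \notin names v ->
  codes (r ++ Bar a :: p) v
  = codes (transp_act a c r ++ Bar c :: p) (transp_act a c v).
Proof.
move=> ac; elim: v r => //= l v IHv r; rewrite inE negb_or => /andP[cl cv].
congr (_ :: _); last by rewrite -!cat_cons IHv.
have -> : letter_name (letter_map (transp a c) l) = transp a c (letter_name l).
  by case: l {cl}.
by rewrite -!cat_cons (@code_transp a c _ (l :: r)) // eq_sym.
Qed.

Lemma alpha_step_codes x y : alpha_step x y -> codes [::] x = codes [::] y.
Proof.
case=> w a v b u [c []]; rewrite !inE negb_or => /andP[ca cb] cv cu E.
rewrite !codes_cat /=; congr (_ ++ _ :: _); first by rewrite /code /= !eqxx.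
rewrite (@codes_transp a c [::]) ?(@codes_transp b c [::]) //=.
- by rewrite E.
- by rewrite eq_sym.
- by rewrite eq_sym.
Qed.

Lemma alpha_eq_codes x y : alpha_eq x y -> codes [::] x = codes [::] y.
Proof. by elim=> {x y} [x y /alpha_step_codes|x|x y _ ->|x y z _ -> _ ->]. Qed.

(** The letter at a common binder distance carries both names; a free code is the name itself. *)
Lemma code_inj a b p : code a p = code b p -> a = b.
Proof.
rewrite /code; case: ifP => Ha; case: ifP => Hb => //; last by case.
case=> E; have := nth_find (Plain a) Ha; have := nth_find (Plain a) Hb.
rewrite -E; case: (nth _ _ _) => //= c /eqP-> /eqP; exact: esym.
Qed.

(** The two renamings can differ only at [c] and [d]. *)
Lemma transp_act_comp a c d v : c \notin names v -> d \notin names v ->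
  transp_act a d v = transp_act c d (transp_act a c v).
Proof.
elim: v => //= l v IHv; rewrite !inE !negb_or => /andP[cl cv] /andP[dl dv].
rewrite IHv //; congr (_ :: _).
have E : transp a d (letter_name l)
         = transp c d (transp a c (letter_name l)).
  have [ld lc] : (letter_name l == d) = false /\ (letter_name l == c) = false.
    by rewrite ![letter_name l == _]eq_sym (negbTE dl) (negbTE cl).
  rewrite /transp; case: (letter_name l == a) => /=; first by rewrite eqxx.
  by rewrite ld lc lc ld.
by case: l E {cl dl} => b /= ->.
Qed.

Hypothesis fresh : forall s : seq A, exists a : A, a \notin s.

Lemma alpha_step_rename w a c v : c \notin names v ->
  alpha_step (w ++ Bar a :: v) (w ++ Bar c :: transp_act a c v).
Proof.
move=> cv; have [d] := fresh [:: a, c & names v ++ names (transp_act a c v)].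
rewrite !inE !mem_cat !negb_or => /and4P[da dc dv dtv].
constructor; exists d; split=> //; first by rewrite !inE negb_or da.
exact: transp_act_comp.
Qed.

(** Induction on the length of the suffix, moving its first letter into the common prefix. Equal
    codes exclude a plain letter facing a bar letter and make two plain letters equal; two bar
    letters are first renamed to one fresh name, which leaves the codes intact. *)
Lemma codes_alpha_eq_suffix w x y :
  codes [::] (w ++ x) = codes [::] (w ++ y) -> alpha_eq (w ++ x) (w ++ y).
Proof.
have [n] := ubnP (size x); elim: n => // n IHn in w x y *.
case: x => [|l x].
  move=> _ /(congr1 size); rewrite !size_codes !size_cat => /eqP.
  by rewrite eqn_add2l => /eqP/esym/size0nil->; apply: rst_refl.
case: y => [|l' y].
  move=> _ /(congr1 size); rewrite !size_codes !size_cat => /eqP.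
  by rewrite eqn_add2l.
rewrite /= ltnS => sz E.
have Ehd : code (letter_name l) (l :: rev w) = code (letter_name l') (l' :: rev w).
  move/(congr1 (drop (size w))): E; rewrite !codes_cat /= cats0.
  by rewrite !drop_size_cat ?size_codes // => -[].
have plain_step k : l = Plain k -> l' = Plain k ->
    alpha_eq (w ++ l :: x) (w ++ l' :: y).
  move=> El El'; subst l l'; rewrite -!cat_rcons; apply: IHn => //.
  by rewrite !cat_rcons.
case: l Ehd E plain_step => a; case: l' => b Ehd E plain_step.
- suff ab : a = b by subst b; apply: (plain_step a).
  apply: (@code_inj _ _ (rev w)); move: Ehd; rewrite /code /=.
  by case: ifP => _; case: ifP => _ //; case=> ->.
- by move: Ehd; rewrite /code /= eqxx; case: ifP.
- by move: Ehd; rewrite /code /= eqxx; case: ifP.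
have [c] := fresh (names x ++ names y).
rewrite mem_cat negb_or => /andP[cx cy].
have sx := alpha_step_rename w a cx; have sy := alpha_step_rename w b cy.
apply: rst_trans (rst_step _ _ _ _ sx) _.
apply: rst_trans (rst_sym _ _ _ _ (rst_step _ _ _ _ sy)).
rewrite -!cat_rcons; apply: IHn; first by rewrite size_map.
by rewrite !cat_rcons -(alpha_step_codes sx) -(alpha_step_codes sy).
Qed.

Lemma alpha_eqP x y : alpha_eq x y <-> codes [::] x = codes [::] y.
Proof. by split; [apply: alpha_eq_codes | apply: (@codes_alpha_eq_suffix [::])]. Qed.

Definition code_at (x : inf_bar_string A) (i : nat) : nat + A :=
  code (letter_name (x i)) (rev (mkseq x i.+1)).

Lemma mkseqS_rcons T (f : nat -> T) n : mkseq f n.+1 = rcons (mkseq f n) (f n).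
Proof. by rewrite /mkseq -addn1 iotaD map_cat cats1. Qed.

Lemma codes_mkseq (x : inf_bar_string A) n :
  codes [::] (mkseq x n) = mkseq (code_at x) n.
Proof.
elim: n => // n IHn; rewrite !mkseqS_rcons -2!cats1 codes_cat IHn /= cats0.
by rewrite /code_at mkseqS_rcons rev_rcons.
Qed.

Lemma alpha_eq_infP (x y : inf_bar_string A) :
  alpha_eq_inf x y <-> code_at x =1 code_at y.
Proof.
split=> [H i|H n].
  have /alpha_eqP := H i.+1; rewrite !codes_mkseq !mkseqS_rcons.
  by move/rcons_inj => [].
by apply/alpha_eqP; rewrite !codes_mkseq; apply: eq_mkseq.
Qed.

(** * Codes of ultimately periodic words *)

Section CodeAt.
Variable x : inf_bar_string A.

Let bnd i j := binds (letter_name (x i)) (x j).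

Lemma code_at_bound i j : j <= i -> bnd i j ->
  (forall k, j < k <= i -> ~~ bnd i k) -> code_at x i = inl (i - j).
Proof.
move=> ji bij nb; rewrite /code_at /code.
have nthE k : k <= i -> nth (x 0) (rev (mkseq x i.+1)) k = x (i - k).
  by move=> ki; rewrite nth_rev size_mkseq ?subSS ?nth_mkseq // ltnS leq_subr.
have Hh : has (binds (letter_name (x i))) (rev (mkseq x i.+1)).
  apply/(has_nthP (x 0)); exists (i - j).
    by rewrite size_rev size_mkseq ltnS leq_subr.
  by rewrite nthE ?leq_subr // subKn.
rewrite Hh; congr inl; apply/eqP; rewrite eqn_leq; apply/andP; split.
  rewrite leqNgt; apply/negP => /(before_find (x 0)).
  by rewrite nthE ?leq_subr // subKn // -/(bnd i j) bij.
set f := find _ _; rewrite leqNgt; apply/negP => fl.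
have fi : f <= i by apply: leq_trans (ltnW fl) (leq_subr _ _).
have := nth_find (x 0) Hh; rewrite -/f nthE //; apply/negP; apply: nb; lia.
Qed.

Lemma code_at_free i : (forall k, k <= i -> ~~ bnd i k) ->
  code_at x i = inr (letter_name (x i)).
Proof.
move=> nb; rewrite /code_at /code ifN //; apply/negP.
case/(has_nthP (x 0)) => k; rewrite size_rev size_mkseq => ki.
rewrite nth_rev size_mkseq // subSS nth_mkseq ?ltnS ?leq_subr //.
by apply/negP/nb/leq_subr.
Qed.

Lemma last_binder i : (forall k, k <= i -> ~~ bnd i k) \/
  exists j, [/\ j <= i, bnd i j & forall k, j < k <= i -> ~~ bnd i k].
Proof.
case: (boolP [exists j : 'I_i.+1, bnd i j]) => [/existsP[j0 bj0]|/existsPn H].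
  right.
  case: (@ex_maxnP (fun j => (j <= i) && bnd i j) i).
  - by exists j0; rewrite -ltnS ltn_ord.
  - by move=> j /andP[].
  move=> j /andP[ji bj] mx; exists j; split=> // k /andP[jk ki].
  by apply/negP => bk; have := mx k; rewrite ki bk => /(_ isT); lia.
by left=> k ki; have := H (inord k); rewrite inordK.
Qed.

(* A binder before the threshold [M] recedes when [i] moves on by a period,
   while one after [M] moves along with [i]; both facts only depend on the
   code itself. *)
Definition code_shift M P i (c : nat + A) : nat + A :=
  match c with
  | inl d => if i - d < M then inl (d + P) else inl d
  | inr a => inr a
  end.

(** As [M + V <= i], the positions from [M] to [i] cover a whole period. A name without binder there
    acquires none up to [i + P]; hence the last binder, at [j] for position [i], is for [i + P]
    still at [j] if [j < M] and at [j + P] otherwise. *)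
Lemma code_at_shift M V P i : 0 < V -> V %| P ->
  (forall j, M <= j -> x (j + V) = x j) -> M + V <= i ->
  code_at x (i + P) = code_shift M P i (code_at x i).
Proof.
move=> V0 /dvdnP[n ->] per Mi.
have pern m j : M <= j -> x (j + m * V) = x j.
  elim: m => [|m IHm] Mj; first by rewrite addn0.
  by rewrite mulSn addnCA addnC per ?IHm // (leq_trans Mj) // leq_addr.
have xiP : x (i + n * V) = x i by apply: pern; lia.
have bP k : M <= k -> bnd (i + n * V) (k + n * V) = bnd i k.
  by move=> Mk; rewrite /bnd xiP pern.
have bQ k : bnd (i + n * V) k = bnd i k by rewrite /bnd xiP.
(* A position past [M] is reduced modulo [V] into the first period after [M], which lies below
   [i]. *)
have full j : (forall k, j < k <= i -> ~~ bnd i k) -> j < M ->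
    forall k, j < k <= i + n * V -> ~~ bnd i k.
  move=> nb jM k /andP[jk ki].
  case: (ltnP k M) => [kM|Mk]; first by apply: nb; lia.
  have := divn_eq (k - M) V; set q := _ %/ _; set r := _ %% _ => E.
  have rV : r < V by rewrite ltn_mod.
  have -> : k = M + r + q * V by lia.
  by rewrite /bnd pern ?leq_addr //; apply: nb; lia.
have [nb|[j [ji bj nb]]] := last_binder i.
  rewrite (code_at_free nb) /= code_at_free ?xiP // => k ki.
  rewrite bQ.
  (* [full] needs some [j] below [M] and says nothing about [j] itself, so position 0 and the case
     [M = 0] are treated apart. *)
  case: k ki => [|k] ki; first by apply: nb.
  case: (posnP M) => [M0|Mpos].
    have := divn_eq k.+1 V; set q := _ %/ _; set r := _ %% _ => E.
    have rV : r < V by rewrite ltn_mod.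
    rewrite /bnd E addnC pern ?M0 //; apply: nb; lia.
  apply: (full 0) => //; move=> k' /andP[_]; exact: nb.
rewrite (code_at_bound ji bj nb) /= subKn //.
case: ltnP => jM.
  rewrite (@code_at_bound _ j); first by congr inl; lia.
  - lia.
  - by rewrite bQ.
  by move=> k kk; rewrite bQ; apply: (full j).
rewrite (@code_at_bound _ (j + n * V)); first by congr inl; lia.
- lia.
- by rewrite bP.
move=> k kk; have -> : k = (k - n * V) + n * V by lia.
by rewrite bP; [apply: nb|]; lia.
Qed.

End CodeAt.

Lemma up_word_periodic (p : up_pair A) j : size (up_u p) <= j ->
  up_word p (j + size (up_v p)) = up_word p j.
Proof.
move=> uj; rewrite /up_word ltnNge (leq_trans uj) ?leq_addr //= ltnNge uj /=.
by rewrite addnC -addnBA // modnDl.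
Qed.

(** Strong induction: from [N] on, both codes arise from those at [i - V * V'] by the same
    [code_shift], with common threshold [U + U'] and common period [V * V']. The summands [V] and
    [V'] leave room for a period of either word between the threshold and [i - V * V']. *)
Lemma code_at_up_word (p q : up_pair A) N :
  size (up_u p) + size (up_u q) + size (up_v p) + size (up_v q)
    + size (up_v p) * size (up_v q) <= N ->
  (forall i, i < N -> code_at (up_word p) i = code_at (up_word q) i) ->
  code_at (up_word p) =1 code_at (up_word q).
Proof.
set U := size (up_u p); set U' := size (up_u q).
set V := size (up_v p); set V' := size (up_v q) => bN H i.
have V0 : 0 < V by []. have V'0 : 0 < V' by [].
have [n] := ubnP i; elim: n i => // n IHn i; rewrite ltnS => ile.
case: (ltnP i N) => [|Ni]; first exact: H.
have P0 : 0 < V * V' by rewrite muln_gt0 V0 V'0.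
have E : i = (i - V * V') + V * V' by lia.
rewrite E (@code_at_shift _ (U + U') V) ?dvdn_mulr //; first last.
- lia.
- by move=> j Uj; apply: up_word_periodic; apply: leq_trans Uj; apply: leq_addr.
rewrite (@code_at_shift _ (U + U') V') ?dvdn_mull //; first last.
- lia.
- by move=> j Uj; apply: up_word_periodic; apply: leq_trans Uj; apply: leq_addl.
by rewrite IHn //; lia.
Qed.

End AlphaEquivalence.

(** * Stack programs and their compilation to Turing machines *)

Section StackPrograms.
Variable S : finType.

(* A state is a list of stacks with the top at the head; [Push r f] computes the
   symbol to push, if any, from the tops of all stacks. *)
Inductive prog : Type :=
  | Push of nat & (seq (option S) -> option S)
  | Pop of nat
  | Seq of prog & prog
  | While of (seq (option S) -> bool) & prog.

Fixpoint upd (s : seq (seq S)) (r : nat) (l : seq S) : seq (seq S) :=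
  match s, r with
  | [::], _ => [::]
  | _ :: s', 0 => l :: s'
  | l' :: s', r'.+1 => l' :: upd s' r' l
  end.

Definition tops (s : seq (seq S)) : seq (option S) := map ohead s.

Definition push (r : nat) (g : option S) (s : seq (seq S)) : seq (seq S) :=
  if g is Some x then upd s r (x :: nth [::] s r) else s.

Definition pop (r : nat) (s : seq (seq S)) : seq (seq S) :=
  upd s r (behead (nth [::] s r)).

(* [t] in [exec p s s' t] is an upper bound on the number of machine steps. *)
Inductive exec : prog -> seq (seq S) -> seq (seq S) -> nat -> Prop :=
  | ExecPush r f s : exec (Push r f) s (push r (f (tops s)) s) 2
  | ExecPop r s : exec (Pop r) s (pop r s) 1
  | ExecSeq p q (s s' s'' : seq (seq S)) m n :
      exec p s s' m -> exec q s' s'' n ->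
      exec (Seq p q) s s'' (m + n)
  | ExecWhileF (b : seq (option S) -> bool) p s :
      ~~ b (tops s) -> exec (While b p) s s 1
  | ExecWhileT (b : seq (option S) -> bool) p (s s' s'' : seq (seq S)) m n :
      b (tops s) -> exec p s s' m ->
      exec (While b p) s' s'' n -> exec (While b p) s s'' (m + n).+1
  | ExecLe p s s' m n : m <= n -> exec p s s' m -> exec p s s' n.

Lemma size_upd s r l : size (upd s r l) = size s.
Proof. by elim: s r => [|l0 s IHs] [|r] //=; rewrite IHs. Qed.

Lemma nth_upd s r l i :
  nth [::] (upd s r l) i = if (i == r) && (r < size s) then l else nth [::] s i.
Proof.
elim: s r i => [|l0 s IHs] [|r] [|i] //=; by rewrite ?andbF ?nth_nil ?IHs.
Qed.

Lemma size_push r g s : size (push r g s) = size s.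
Proof. by case: g => //= x; rewrite size_upd. Qed.

Lemma size_pop r s : size (pop r s) = size s.
Proof. exact: size_upd. Qed.

End StackPrograms.

Arguments Pop {S} r.

(** * Machine fragments and their simulation of stack programs *)

Section Compilation.
Variables (S : finType) (k : nat).

Notation sym := (option (S + void)).
Notation tapes := ('I_k.+1 -> tape (S + void)).

Inductive tape_op : Type := OpPop | OpLeft | OpWrite of S.

Definition op_act (op : tape_op) (x : sym) : sym * move :=
  match op with
  | OpPop => (None, MoveRight)
  | OpLeft => (x, MoveLeft)
  | OpWrite g => (Some (inl g), Stay)
  end.

Definition action (a : option (nat * tape_op)) (i : nat) (x : sym) : sym * move :=
  if a is Some (r, op) then if i == r then op_act op x else (x, Stay)
  else (x, Stay).

(* The successor state [None] leaves the fragment. *)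
Record fragment : Type := Fragment {
  fstate : finType;
  fstart : fstate;
  ftrans : fstate -> seq (option S) ->
    option fstate * option (nat * tape_op)
}.

(** Moving left changes what is read, so the symbol is computed beforehand and kept in the state
    until it is written. *)
Definition frag_push r (f : seq (option S) -> option S) : fragment :=
  @Fragment (option S : finType) None (fun q rs =>
    match q with
    | None => if f rs is Some g then (Some (Some g), Some (r, OpLeft))
              else (None, None)
    | Some g => (None, Some (r, OpWrite g))
    end).

Definition frag_pop r : fragment :=
  @Fragment unit tt (fun _ _ => (None, Some (r, OpPop))).

Definition frag_seq (F G : fragment) : fragment :=
  @Fragment (fstate F + fstate G)%type (inl (fstart F)) (fun q rs =>
    match q with
    | inl q1 => let: (q', a) := ftrans q1 rs in
        (Some (if q' is Some q2 then inl q2 else inr (fstart G)), a)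
    | inr q1 => let: (q', a) := ftrans q1 rs in (omap inr q', a)
    end).

Definition frag_while (b : seq (option S) -> bool) (F : fragment) : fragment :=
  @Fragment (option (fstate F)) None (fun q rs =>
    match q with
    | None => (if b rs then Some (Some (fstart F)) else None, None)
    | Some q1 => let: (q', a) := ftrans q1 rs in (Some q', a)
    end).

Fixpoint compile (p : prog S) : fragment :=
  match p with
  | Push r f => frag_push r f
  | Pop r => frag_pop r
  | Seq p q => frag_seq (compile p) (compile q)
  | While b p => frag_while b (compile p)
  end.

Definition decode (x : sym) : option S :=
  if x is Some (inl g) then Some g else None.

Definition read_all (x : 'I_k.+1 -> sym) : seq (option S) :=
  [seq decode (x i) | i <- enum 'I_k.+1].

Definition reads (T : tapes) : seq (option S) :=
  read_all (fun i => tape_read (T i)).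

Definition act_all (a : option (nat * tape_op)) (T : tapes) : tapes :=
  fun i => tape_act (T i) (action a i (tape_read (T i))).

Inductive frun (F : fragment) : fstate F -> tapes -> nat -> tapes -> Prop :=
  | FrunExit q T a : ftrans q (reads T) = (None, a) -> frun q T 1 (act_all a T)
  | FrunStep q q' T a n T' : ftrans q (reads T) = (Some q', a) ->
      frun q' (act_all a T) n T' -> frun q T n.+1 T'.

Lemma frun_inr (F G : fragment) (q : fstate G) T n T' :
  frun q T n T' -> @frun (frag_seq F G) (inr q) T n T'.
Proof.
elim=> {q T n T'} [q T a E|q q' T a n T' E _ IH].
  by apply: FrunExit; rewrite /= E.
by apply: FrunStep IH; rewrite /= E.
Qed.

Lemma frun_seq (F G : fragment) (q : fstate F) T m T' n T'' :
  frun q T m T' -> frun (fstart G) T' n T'' ->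
  @frun (frag_seq F G) (inl q) T (m + n) T''.
Proof.
move=> H; elim: H n T'' => {q T m T'} [q T a E|q q' T a m T' E _ IH] n T'' HG.
  by rewrite add1n; apply: FrunStep (frun_inr F HG); rewrite /= E.
by rewrite addSn; apply: FrunStep (IH _ _ HG); rewrite /= E.
Qed.

Lemma frun_while b (F : fragment) (q : fstate F) T m T' n T'' :
  frun q T m T' -> @frun (frag_while b F) None T' n T'' ->
  @frun (frag_while b F) (Some q) T (m + n) T''.
Proof.
move=> H; elim: H n T'' => {q T m T'} [q T a E|q q' T a m T' E _ IH] n T'' HG.
  by rewrite add1n; apply: FrunStep HG; rewrite /= E.
by rewrite addSn; apply: FrunStep (IH _ _ HG); rewrite /= E.
Qed.

(* The top of the stack is under the head, the bottom on the right; popped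
   cells are blanked. *)
Definition tape_rep (l : seq S) (t : tape (S + void)) : Prop :=
  exists m n, t = Tape (nseq m None) ([seq Some (inl g) | g <- l] ++ nseq n None).

Definition rep (s : seq (seq S)) (T : tapes) : Prop :=
  size s = k.+1 /\ forall i : 'I_k.+1, tape_rep (nth [::] s i) (T i).

Lemma tape_rep_read l t : tape_rep l t -> decode (tape_read t) = ohead l.
Proof. by case=> m [n ->]; case: l => //; case: n. Qed.

Lemma rep_reads s T : rep s T -> reads T = tops s.
Proof.
case=> sz H; apply: (@eq_from_nth _ None).
  by rewrite size_map size_enum_ord size_map sz.
move=> i; rewrite size_map size_enum_ord => ik.
rewrite (nth_map ord0) ?size_enum_ord // (nth_map [::]) ?sz //.
by rewrite (tape_rep_read (H _)) nth_enum_ord.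
Qed.

(** Writing back on an exhausted cell list makes a blank explicit; the free number of trailing
    blanks in [tape_rep] absorbs it. *)
Lemma tape_rep_stay l t : tape_rep l t ->
  tape_rep l (tape_act t (tape_read t, Stay)).
Proof.
case=> m [n ->]; case: l => [|g l]; last by exists m, n.
by case: n => [|n]; [exists m, 1 | exists m, n.+1].
Qed.

Lemma tape_rep_pop l t : tape_rep l t ->
  tape_rep (behead l) (tape_act t (None, MoveRight)).
Proof.
case=> m [n ->]; case: l => [|g l]; last by exists m.+1, n.
by case: n => [|n]; [exists m.+1, 0 | exists m.+1, n].
Qed.

Lemma tape_rep_push l t g : tape_rep l t ->
  tape_rep (g :: l)
    (tape_act (tape_act t (tape_read t, MoveLeft)) (Some (inl g), Stay)).
Proof.
case=> m [n ->]; case: l => [|x l]; last first.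
  by case: m => [|m]; [exists 0, n | exists m, n].
by case: m => [|m]; case: n => [|n];
  [exists 0, 1 | exists 0, n.+1 | exists m, 1 | exists m, n.+1].
Qed.

Lemma rep_act_none s T : rep s T -> rep s (act_all None T).
Proof. by case=> sz H; split=> // i; apply: tape_rep_stay. Qed.

Lemma rep_pop r s T : rep s T -> rep (pop r s) (act_all (Some (r, OpPop)) T).
Proof.
case=> sz H; split=> [|i]; first by rewrite size_pop.
rewrite nth_upd /act_all /=; case: eqP => [<-|_] /=.
  by rewrite sz ltn_ord; apply: tape_rep_pop.
exact: tape_rep_stay.
Qed.

Lemma rep_push r g s T : rep s T ->
  rep (push r (Some g) s)
    (act_all (Some (r, OpWrite g)) (act_all (Some (r, OpLeft)) T)).
Proof.
case=> sz H; split=> [|i]; first by rewrite size_push.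
rewrite nth_upd /act_all /=; case: eqP => [<-|_] /=.
  by rewrite sz ltn_ord; apply: tape_rep_push.
by do 2 apply: tape_rep_stay.
Qed.

(** Induction on the execution. Loop tests and empty pushes still rewrite the scanned cells, whence
    [rep_act_none]. *)
Lemma compile_correct p s s' t T : exec p s s' t -> rep s T ->
  exists n T', [/\ n <= t, frun (fstart (compile p)) T n T' & rep s' T'].
Proof.
move=> H; elim: H T => {p s s' t}.
- move=> r f s T RT; case E: (f (tops s)) => [g|].
    exists 2, (act_all (Some (r, OpWrite g)) (act_all (Some (r, OpLeft)) T)).
    split=> //; last exact: rep_push.
    apply: (@FrunStep (frag_push r f) None (Some g)); last exact: FrunExit.
    by rewrite /= (rep_reads RT) E.
  exists 1, (act_all None T); split=> //; last exact: rep_act_none.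
  by apply: FrunExit; rewrite /= (rep_reads RT) E.
- move=> r s T RT; exists 1, (act_all (Some (r, OpPop)) T); split=> //.
    exact: FrunExit.
  exact: rep_pop.
- move=> p q s s' s'' m n _ IHp _ IHq T RT.
  have [i [T1 [im R1 rep1]]] := IHp T RT.
  have [j [T2 [jn R2 rep2]]] := IHq T1 rep1.
  by exists (i + j), T2; split=> //; [apply: leq_add | apply: frun_seq R1 R2].
- move=> b p s nb T RT; exists 1, (act_all None T); split=> //.
    by apply: FrunExit; rewrite /= (rep_reads RT) (negbTE nb).
  exact: rep_act_none.
- move=> b p s s' s'' m n bs _ IHp _ IHw T RT.
  have [i [T1 [im R1 rep1]]] := IHp _ (rep_act_none RT).
  have [j [T2 [jn R2 rep2]]] := IHw T1 rep1.
  exists (i + j).+1, T2; split=> //; first by rewrite ltnS leq_add.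
  apply: (@FrunStep (frag_while b (compile p)) _ (Some (fstart (compile p)))).
    by rewrite /= (rep_reads RT) bs.
  exact: frun_while R1 R2.
- move=> p s s' m n mn _ IH T RT.
  have [i [T1 [im R1 rep1]]] := IH T RT.
  by exists i, T1; split=> //; apply: leq_trans mn.
Qed.

Variable (p : prog S) (out : seq (option S) -> bool).

Let F := compile p.

(** The input alphabet suffices, so the work alphabet is [void]. State [inr None] spends one extra
    step on reading the final tops; [inr (Some _)] halts. *)
Definition tm_of_prog : tm S :=
  @TM S k void (fstate F + option bool)%type (inl (fstart F))
    (fun q => if q is inr r then r else None)
    (fun q rs =>
       match q with
       | inl q1 => let: (q', a) := ftrans q1 (read_all rs) in
           (if q' is Some q2 then inl q2 else inr None,
            fun i : 'I_k.+1 => action a i (rs i))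
       | inr _ => (inr (Some (out (read_all rs))), fun i : 'I_k.+1 => (rs i, Stay))
       end).

Lemma eq_read_all x y : x =1 y -> read_all x = read_all y.
Proof. by move=> E; apply: eq_map => i; rewrite E. Qed.

(* Configurations contain functions, which are only compared pointwise. *)
Definition cfg_at (q : tm_state tm_of_prog) (T : tapes) (c : tm_config tm_of_prog) :=
  cfg_state c = q /\ cfg_tape c =1 T.

Lemma tm_step_frag q q' T a c : cfg_at (inl q) T c ->
  ftrans q (reads T) = (q', a) ->
  cfg_at (if q' is Some q2 then inl q2 else inr None) (act_all a T) (tm_step c).
Proof.
case: c => q0 T0 [/= -> ET] E; rewrite /tm_step /=.
have -> : read_all [ffun i => tape_read (T0 i)] = reads T.
  by apply: eq_read_all => i; rewrite ffunE ET.
by rewrite E; split=> //= i; rewrite ffunE ET.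
Qed.

Lemma tm_run_frag q T n T' c : frun q T n T' -> cfg_at (inl q) T c ->
  cfg_at (inr None) T' (iter n (@tm_step S tm_of_prog) c).
Proof.
move=> H; elim: H c => {q T n T'} [q T a E|q q' T a n T' E _ IH] c Hc.
  exact: (tm_step_frag Hc E).
by rewrite iterSr; apply: IH; apply: (tm_step_frag Hc E).
Qed.

Lemma tm_step_out T c : cfg_at (inr None) T c ->
  tm_answer (cfg_state (tm_step c)) = Some (out (reads T)).
Proof.
case: c => q0 T0 [/= -> ET]; rewrite /tm_step /=; congr (Some (out _)).
by apply: eq_read_all => i; rewrite ffunE ET.
Qed.

Lemma tm_answer_mono (M : tm S) (c : tm_config M) b m n : m <= n ->
  tm_answer (cfg_state (iter m (@tm_step S M) c)) = Some b ->
  tm_answer (cfg_state (iter n (@tm_step S M) c)) = Some b.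
Proof.
move=> /subnK<- H; elim: (n - m) => // i IHi.
by rewrite addSn iterS {1}/tm_step IHi.
Qed.

Lemma tm_of_prog_correct w s' t :
  exec p (w :: nseq k [::]) s' t ->
  tm_answers_within tm_of_prog w t.+1 (out (tops s')).
Proof.
move=> E.
pose c := tm_init tm_of_prog w.
have R0 : rep (w :: nseq k [::]) (cfg_tape c).
  split=> [|i]; first by rewrite /= size_nseq.
  exists 0, 0; rewrite /= cats0; congr Tape.
  case: i => [[|i] ik] //=; by rewrite nth_nseq if_same.
have [n [T' [nt R /rep_reads<-]]] := compile_correct E R0.
apply: (@tm_answer_mono _ _ _ n.+1) => //; rewrite iterS.
by apply: tm_step_out; apply: tm_run_frag R _.
Qed.

End Compilation.

(** * Loop-free programs and transfer loops *)

Section Transfer.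
Variable S : finType.
Implicit Types (p : prog S) (s : seq (seq S)) (r : nat) (l z : seq S).

Fixpoint straight p : bool :=
  match p with
  | Push _ _ | Pop _ => true
  | Seq p q => straight p && straight q
  | While _ _ => false
  end.

(** Loop-free programs run by mere computation. The values of [eval] and [cost] at [While] are
    dummies, excluded by [straight]. *)
Fixpoint eval p s : seq (seq S) :=
  match p with
  | Push r f => push r (f (tops s)) s
  | Pop r => pop r s
  | Seq p q => eval q (eval p s)
  | While _ _ => s
  end.

Fixpoint cost p : nat :=
  match p with
  | Push _ _ => 2
  | Pop _ => 1
  | Seq p q => cost p + cost q
  | While _ _ => 0
  end.

Lemma exec_straight p s : straight p -> exec p s (eval p s) (cost p).
Proof.
elim: p s => //= [r f|r|p IHp q IHq] s.
- by move=> _; apply: ExecPush.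
- by move=> _; apply: ExecPop.
by case/andP=> /IHp Hp /IHq Hq; apply: ExecSeq (Hp _) (Hq _).
Qed.

Lemma exec_straight_eq p s s' t :
  straight p -> eval p s = s' -> cost p <= t -> exec p s s' t.
Proof. by move=> Hp <- Ht; apply: ExecLe Ht _; apply: exec_straight. Qed.

Lemma exec_while_straight (b : seq (option S) -> bool) p s s' n :
  straight p -> b (tops s) ->
  exec (While b p) (eval p s) s' n -> exec (While b p) s s' (cost p + n).+1.
Proof. by move=> /exec_straight Hp bs; apply: ExecWhileT. Qed.

Definition copy r r' : prog S := Push r' (fun tp => nth None tp r).

(** Moving symbols reverses their order. The pop follows all copies, so every destination receives
    the same top. *)
Definition transfer (c : option S -> bool) r (rs : seq nat) : prog S :=
  While (fun tp => c (nth None tp r))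
        (foldr (fun r' p => Seq (copy r r') p) (Pop r) rs).

Definition transferred r (rs : seq nat) l z s : seq (seq S) :=
  mkseq (fun i => if i == r then z
                  else if has (eq_op i) rs then catrev l (nth [::] s i)
                  else nth [::] s i) (size s).

Lemma nth_tops s i : nth None (tops s) i = ohead (nth [::] s i).
Proof.
case: (ltnP i (size s)) => si; first by rewrite (nth_map [::]).
by rewrite !nth_default // size_map.
Qed.

Lemma size_foldr_push r rs p s : (forall s, size (eval p s) = size s) ->
  size (eval (foldr (fun r' p => Seq (copy r r') p) p rs) s) = size s.
Proof.
by move=> Hp; elim: rs s => //= r' rs IHrs s; rewrite IHrs size_push.
Qed.

Lemma eval_transfer r rs s g l : uniq (r :: rs) ->
  all (fun r' => r' < size s) (r :: rs) -> nth [::] s r = g :: l ->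
  eval (foldr (fun r' p => Seq (copy r r') p) (Pop r) rs) s
  = transferred r rs [:: g] l s.
Proof.
move=> U R E; apply: (@eq_from_nth _ [::]).
  by rewrite size_mkseq size_foldr_push // => s'; rewrite size_pop.
rewrite size_foldr_push; last by move=> s'; rewrite size_pop.
move=> i si; rewrite nth_mkseq // => {si}.
move: U R => /= /andP[]; elim: rs s E => [|r' rs IHrs] s E /=.
  move=> _ _ /andP[rs _]; rewrite nth_upd rs E andbT; by case: eqP.
rewrite inE negb_or => /andP[rr' rrs] /andP[r'rs U] /and3P[rs0 r's R].
rewrite nth_tops E /= IHrs // ?nth_upd ?size_upd ?r's ?rs0 ?(negbTE rr') //=.
rewrite andbT; case: (i == r) => //=; case: eqP => //= ->.
suff -> : has (eq_op r') rs = false by [].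
by apply/negP => /hasP[j jrs /eqP e]; rewrite e jrs in r'rs.
Qed.

Lemma transferred_cat r rs l l' z z' s :
  transferred r rs l' z' (transferred r rs l z s)
  = transferred r rs (l ++ l') z' s.
Proof.
rewrite {1}/transferred size_mkseq; apply/eq_in_map => i.
rewrite mem_iota /= add0n => si; rewrite nth_mkseq //.
by case: (i == r) => //; case: has => //; rewrite !catrevE rev_cat catA.
Qed.

(** A round costs two steps per destination, one for the pop and one for the test; the final 1 is
    the failing test. *)
Lemma exec_transfer c r rs s s' l z : uniq (r :: rs) ->
  all (fun r' => r' < size s) (r :: rs) -> nth [::] s r = l ++ z ->
  all (c \o Some) l -> ~~ c (ohead z) -> s' = transferred r rs l z s ->
  exec (transfer c r rs) s s' ((size rs * 2 + 2) * size l + 1).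
Proof.
move=> U R E cl cz ->.
elim: l s R E cl => [|g l IHl] s R /= E.
  move=> _; rewrite muln0.
  have -> : transferred r rs [::] z s = s.
    apply: (@eq_from_nth _ [::]); rewrite size_mkseq // => i si.
    by rewrite nth_mkseq //= -E; case: eqP => [->|_] //; case: ifP.
  by apply: ExecWhileF; rewrite nth_tops E.
case/andP=> cg cl.
apply: ExecLe; last first.
  apply: exec_while_straight; first by elim: (rs).
    by rewrite nth_tops E.
  rewrite (@eval_transfer _ _ _ g (l ++ z)) //.
  rewrite -[g :: l]/([:: g] ++ l) -(transferred_cat _ _ [:: g] l (l ++ z)).
  apply: IHl => //; first by move: R; rewrite size_mkseq.
  by rewrite nth_mkseq ?eqxx //; case/andP: R.
have -> : cost (foldr (fun r' p => Seq (copy r r') p) (Pop r) rs) = size rs * 2 + 1.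
  by elim: (rs) => //= r' rs' ->; lia.
by rewrite /=; lia.
Qed.

Lemma exec_transfer_all r rs s s' l : uniq (r :: rs) ->
  all (fun r' => r' < size s) (r :: rs) -> nth [::] s r = l ->
  s' = transferred r rs l [::] s ->
  exec (transfer isSome r rs) s s' ((size rs * 2 + 2) * size l + 1).
Proof.
move=> U R E ->; apply: (@exec_transfer isSome r rs s _ l [::]) => //.
  by rewrite cats0.
by apply/allP.
Qed.

End Transfer.

(** * Stack programs of the decision procedure *)

Notation sym := input_symbol.
Notation bits := (map Bit).
(* Registers: 0 holds the input and later the compared part of a name, 1 and 2
   hold the names of the two current letters (before: u0 and u1 reversed), 3 the
   letters processed so far (before: a unary counter), 4 the part of register 3
   already searched (before: a counter), 5 and 6 the letters still to be read,
   7 and 8 flag that a letter does not bind the current name, 9 flags that a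
   binder was found, 10 flags inequivalence, 11 and 12 hold v0 and v1 reversed,
   13 the length of the four words in unary. *)
Notation regs T A B P Q X Y E E' D R V V' C :=
  [:: T; A; B; P; Q; X; Y; E; E'; D; R; V; V'; C] (only parsing).

Definition flag (b : bool) : seq sym := if b then [:: Sep] else [::].

(* Raises the flag in register [r], leaving an already raised one alone, so
   that a flag register never holds more than one symbol. *)
Definition raise_if (r : nat) (c : seq (option sym) -> bool) : prog sym :=
  Push r (fun tp => if c tp && (nth None tp r == None) then Some Sep else None).

Definition is_bit (g : option sym) : bool :=
  if g is Some (Bit _) then true else false.

(** The name arrives reversed in both registers, above its mark in register 3, so comparing from the
    tops needs no reversal. *)
Definition load (X A : nat) : prog sym :=
  Seq (Seq (copy sym X 3) (Pop X)) (transfer is_bit X [:: 3; A]).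

(** The letter passes from register 3 to register 4 whatever the outcome; register 0 keeps the
    consumed part of the name for its restoration. *)
Definition match_name (A E : nat) : prog sym :=
  Seq (While (fun tp => is_bit (nth None tp 3))
    (Seq (raise_if E (fun tp => nth None tp 3 != nth None tp A))
    (Seq (copy sym 3 4) (Seq (Pop 3) (Seq (copy sym A 0) (Pop A))))))
  (Seq (Seq (raise_if E (fun tp =>
              (nth None tp A != None) || (nth None tp 3 != Some (Mark true))))
       (Seq (copy sym 3 4) (Pop 3)))
  (transfer isSome 0 [:: A])).

(** In register 3 the letter of the second word lies on top, so that side is matched first. A binder
    on one side only makes the codes differ and raises flag 10. *)
Definition walk : prog sym :=
  While (fun tp => (nth None tp 3 != None) && (nth None tp 9 == None))
    (Seq (match_name 2 8) (Seq (match_name 1 7)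
    (Seq (raise_if 10 (fun tp =>
            (nth None tp 7 == None) != (nth None tp 8 == None)))
    (Seq (raise_if 9 (fun tp =>
            (nth None tp 7 == None) || (nth None tp 8 == None)))
    (Seq (Pop 7) (Pop 8)))))).

(** Names matter only if the walk met no binder; otherwise the loop merely empties both registers
    for the next pair. *)
Definition compare_names : prog sym :=
  Seq (While (fun tp => (nth None tp 1 != None) || (nth None tp 2 != None))
    (Seq (raise_if 10 (fun tp =>
            (nth None tp 1 != nth None tp 2) && (nth None tp 9 == None)))
    (Seq (Pop 1) (Pop 2)))) (Pop 9).

Definition check_words : prog sym :=
  While (fun tp => (nth None tp 5 != None) && (nth None tp 6 != None))
    (Seq (load 5 1) (Seq (load 6 2) (Seq walk (Seq compare_names
      (transfer isSome 4 [:: 3]))))).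

Definition not_sep (g : option sym) : bool :=
  if g is Some x then x != Sep else false.

Definition read_word (r : nat) : prog sym := transfer not_sep 0 [:: r; 3; 13].

(** The stored word is reversed, so a transfer puts it on [X] in reading order; the copy in register
    0 restores it. *)
Definition prepend (V X : nat) : prog sym :=
  Seq (transfer isSome V [:: 0; X]) (transfer isSome 0 [:: V]).

(** Registers 3 and 13 both hold the total length [n] in unary, so the nested loops prepend [n * n]
    copies of each periodic part. *)
Definition unroll : prog sym :=
  While (fun tp => nth None tp 3 != None)
    (Seq (Pop 3) (Seq (transfer isSome 13 [:: 0])
    (Seq (transfer isSome 0 [:: 13; 4])
    (While (fun tp => nth None tp 4 != None)
      (Seq (Pop 4) (Seq (prepend 11 5) (prepend 12 6))))))).

Definition decide : prog sym :=
  Seq (read_word 1) (Seq (Pop 0) (Seq (read_word 11) (Seq (Pop 0)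
  (Seq (read_word 2) (Seq (Pop 0) (Seq (read_word 12)
  (Seq unroll (Seq (transfer isSome 1 [:: 5]) (Seq (transfer isSome 2 [:: 6])
  check_words))))))))).

(** * Loading letters and matching names *)

Section Specifications.
Implicit Types (a T A B P Q X Y D R V C t p q z : seq sym).
Implicit Types (w x y : seq bool) (k e : bool).

Lemma is_bits (w : seq bool) : all (is_bit \o Some) (bits w).
Proof. by elim: w. Qed.

Definition starts_letter (z : seq sym) : bool := ~~ is_bit (ohead z).

(* [side] selects the first or the second word and its registers. *)
Lemma exec_load (side : bool) k w z T A B P Q X (E E' : seq sym) D R
    V (V' : seq sym) C :
  starts_letter z ->
  let s X' A' P' :=
    if side then regs T A A' P' Q X X' E E' D R V V' C
    else regs T A' A P' Q X' X E E' D R V V' C in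
  exec (load (if side then 6 else 5) (if side then 2 else 1))
    (s (Mark k :: bits w ++ z) B P)
    (s z (catrev (bits w) B) (catrev (bits w) (Mark k :: P)))
    (6 * size w + 4).
Proof.
move=> hz s; rewrite /s {s}; case: side.
all: apply: ExecLe; last (apply: ExecSeq; first exact: exec_straight).
all: try by apply: (@exec_transfer _ _ _ _ _ _ (bits w) z) => //; apply: is_bits.
all: by rewrite size_map /=; lia.
Qed.

(** The loop follows the bits of [x] and sees only the prefix of [y] of that length; an exhausted
    [y] reads as [None] and raises the flag. A round costs 9: one test, three pushes and two
    pops. *)
Lemma exec_match_loop (side : bool) k x y p t q e A X Y (E : seq sym) D R
    V (V' : seq sym) C :
  let A1 := if side then 2 else 1 in
  let E1 := if side then 8 else 7 in
  let s t a p q (f : seq sym) :=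
    if side then regs t A a p q X Y E f D R V V' C
    else regs t a A p q X Y f E D R V V' C in
  exec (While (fun tp => is_bit (nth None tp 3))
    (Seq (raise_if E1 (fun tp => nth None tp 3 != nth None tp A1))
    (Seq (copy sym 3 4) (Seq (Pop 3) (Seq (copy sym A1 0) (Pop A1))))))
    (s t (bits y) (bits x ++ Mark k :: p) q (flag e))
    (s (catrev (bits (take (size x) y)) t) (bits (drop (size x) y)) (Mark k :: p)
       (catrev (bits x) q) (flag (e || (take (size x) y != x))))
    (9 * size x + 1).
Proof.
move=> A1 E1 s; rewrite /A1 /E1 /s {A1 E1 s}.
elim: x y t q e => [|b x IHx] y t q e /=.
  rewrite take0 drop0 eqxx orbF /= muln0.
  by case: side; apply: ExecWhileF.
case: side IHx => IHx;
  (apply: ExecLe; last (apply: (exec_while_straight (n := 9 * size x + 1));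
    [done|done|case: y => [|c y] /=;
      [have := IHx [::] t (Bit b :: q) true;
       rewrite take_oversize // drop_oversize // => H; case: e; exact: H
      |(have -> : (Some (Bit b) != Some (Bit c)) = (c != b) by case: (b); case: (c));
       have := IHx y (Bit c :: t) (Bit b :: q) (e || (c != b));
       rewrite eqseq_cons negb_and orbA => H;
       case: (c != b) H => H; case: e H => H; exact: H]]));
  by rewrite /=; lia.
Qed.

(** The first disjunct is what the loop detects, the second what the test after it adds. *)
Lemma neq_take_drop x y :
  (y != x) = (take (size x) y != x) || (drop (size x) y != [::]).
Proof.
elim: x y => [|b x IHx] [|c y] //=.
by rewrite !eqseq_cons !negb_and IHx orbA.
Qed.

Lemma exec_match_end (side : bool) k y p t q e A X Y (E : seq sym) D R
    V (V' : seq sym) C :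
  let A1 := if side then 2 else 1 in
  let E1 := if side then 8 else 7 in
  let s p q (f : seq sym) :=
    if side then regs t A (bits y) p q X Y E f D R V V' C
    else regs t (bits y) A p q X Y f E D R V V' C in
  exec (Seq (raise_if E1 (fun tp =>
              (nth None tp A1 != None) || (nth None tp 3 != Some (Mark true))))
       (Seq (copy sym 3 4) (Pop 3)))
    (s (Mark k :: p) q (flag e))
    (s p (Mark k :: q) (flag [|| e, y != [::] | ~~ k])) 5.
Proof.
move=> A1 E1 s; rewrite /A1 /E1 /s {A1 E1 s}.
by case: side; case: e; case: k; case: y => [|b y];
  apply: exec_straight_eq.
Qed.

Lemma exec_match_name (side : bool) k x y p q e A X Y (E : seq sym) D R
    V (V' : seq sym) C :
  let A1 := if side then 2 else 1 in
  let E1 := if side then 8 else 7 in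
  let s p q (f : seq sym) :=
    if side then regs [::] A (bits y) p q X Y E f D R V V' C
    else regs [::] (bits y) A p q X Y f E D R V V' C in
  exec (match_name A1 E1)
    (s (bits x ++ Mark k :: p) q (flag e))
    (s p (Mark k :: catrev (bits x) q) (flag [|| e, y != x | ~~ k]))
    (13 * size x + 7).
Proof.
move=> A1 E1 s; rewrite /A1 /E1 /s {A1 E1 s}.
have := exec_match_loop side k x y p [::] q e A X Y E D R V V' C.
have := exec_match_end side k (drop (size x) y) p
  (catrev (bits (take (size x) y)) [::]) (catrev (bits x) q)
  (e || (take (size x) y != x)) A X Y E D R V V' C.
have -> : [|| e || (take (size x) y != x), drop (size x) y != [::] | ~~ k]
  = [|| e, y != x | ~~ k] by rewrite (neq_take_drop x y) !orbA.
rewrite /= => Hend Hloop.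
apply: (@ExecLe _ _ _ _ (9 * size x + 1 + (5 + (4 * size (take (size x) y) + 1)))).
  by rewrite size_take_min; lia.
apply: ExecSeq Hloop (ExecSeq Hend _).
have Et : size (take (size x) y) = size (catrev (bits (take (size x) y)) [::]).
  by rewrite catrevE cats0 size_rev size_map.
rewrite Et; case: side {Hend}; apply: exec_transfer_all => //=;
  by rewrite /transferred /mkseq /= !catrevE !cats0 revK -map_cat cat_take_drop.
Qed.

End Specifications.

(** * The decision procedure *)

Section Checking.
Variables (A : eqType) (nenc : A -> seq bool).
Hypothesis nenc_inj : injective nenc.
Implicit Types (a b : A) (l : letter A) (pp : seq (letter A * letter A)).
Implicit Types (P Q X Y T D V C z q : seq sym).

Notation enc := (enc_letter nenc).
Notation encw := (enc_bar_string nenc).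

Definition is_bar l : bool := if l is Bar _ then true else false.
Definition rname a : seq bool := rev (nenc a).

Lemma rev_enc l :
  rev (enc l) = bits (rname (letter_name l)) ++ [:: Mark (is_bar l)].
Proof. by rewrite /enc_letter rev_cons map_rev cats1. Qed.

Lemma size_enc l : size (enc l) = (size (nenc (letter_name l))).+1.
Proof. by rewrite /= size_map. Qed.

Lemma size_rname a : size (rname a) = size (nenc a).
Proof. exact: size_rev. Qed.

(** The left side is the flag computed by [match_name]; injectivity of [nenc] turns bit comparison
    into name comparison. *)
Lemma rname_neq a l :
  (rname a != rname (letter_name l)) || ~~ is_bar l = ~~ binds a l.
Proof.
rewrite /rname (inj_eq (can_inj revK)) (inj_eq nenc_inj).
by case: l => b /=; rewrite ?orbT ?orbF // eq_sym.
Qed.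

(* The processed letters, latest first; the second word lies on top. *)
Definition encpp pp : seq sym :=
  flatten [seq rev (enc u.2) ++ rev (enc u.1) | u <- pp].

(** Specification of [walk]: the components are the final flag 9 and the contribution to flag 10. *)
Fixpoint search a b pp : bool * bool :=
  if pp is (l, l') :: pp' then
    if binds a l || binds b l' then (true, binds a l != binds b l')
    else search a b pp'
  else (false, false).

Lemma exec_walk_end (m n r : bool) T X Y P Q (N N' : seq sym)
    V (V' : seq sym) C :
  exec (Seq (raise_if 10 (fun tp =>
              (nth None tp 7 == None) != (nth None tp 8 == None)))
    (Seq (raise_if 9 (fun tp =>
              (nth None tp 7 == None) || (nth None tp 8 == None)))
    (Seq (Pop 7) (Pop 8))))
    (regs T N N' P Q X Y (flag (~~ m)) (flag (~~ n)) [::] (flag r) V V' C)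
    (regs T N N' P Q X Y [::] [::] (flag (m || n)) (flag (r || (m != n))) V V' C) 6.
Proof. by case: m; case: n; case: r; apply: exec_straight_eq. Qed.

(** [z1] is the part searched and [z2] the part left. The factor 17 covers 13 steps per bit and the
    constant cost of a pair, charged to its two marks. *)
Lemma exec_walk a b pp q r X Y V (V' : seq sym) C : exists z1 z2,
  encpp pp = z1 ++ z2 /\
  exec walk
    (regs [::] (bits (rname a)) (bits (rname b)) (encpp pp) q X Y
      [::] [::] [::] (flag r) V V' C)
    (regs [::] (bits (rname a)) (bits (rname b)) z2 (catrev z1 q) X Y
      [::] [::] (flag (search a b pp).1) (flag (r || (search a b pp).2)) V V' C)
    (17 * size (encpp pp) + 1).
Proof.
elim: pp q r => [|[l l'] pp IHpp] q r.
  exists [::], [::]; split=> //; rewrite orbF; exact: ExecWhileF.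
pose w := rname (letter_name l); pose w' := rname (letter_name l').
have Epp : encpp ((l, l') :: pp)
    = bits w' ++ Mark (is_bar l') :: bits w ++ Mark (is_bar l) :: encpp pp.
  by rewrite {1}/encpp /= !rev_enc -!catA.
have M' := @exec_match_name true (is_bar l') w' (rname b)
  (bits w ++ Mark (is_bar l) :: encpp pp) q false
  (bits (rname a)) X Y [::] [::] (flag r) V V' C.
have M := @exec_match_name false (is_bar l) w (rname a)
  (encpp pp) (Mark (is_bar l') :: catrev (bits w') q) false
  (bits (rname b)) X Y (flag (~~ binds b l')) [::] (flag r) V V' C.
rewrite /= !rname_neq in M M'.
pose q1 :=
  Mark (is_bar l) :: catrev (bits w) (Mark (is_bar l') :: catrev (bits w') q).
rewrite -/q1 in M.
have E := @exec_walk_end (binds a l) (binds b l') r [::] X Y (encpp pp)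
  q1 (bits (rname a)) (bits (rname b)) V V' C.
have Eq1 : q1
    = catrev (bits w' ++ Mark (is_bar l') :: bits w ++ [:: Mark (is_bar l)]) q.
  by rewrite /q1 !catrevE !(rev_cat, rev_cons) -!cats1 -!catA.
have sz : size (encpp ((l, l') :: pp))
    = (size w).+1 + (size w').+1 + size (encpp pp).
  by rewrite Epp !size_cat /= !size_cat /= !size_map; lia.
(* The mark keeps register 3 nonempty even if the name is encoded by the empty word. *)
have tst : (nth None (tops (regs [::] (bits (rname a)) (bits (rname b))
   (encpp ((l, l') :: pp)) q X Y [::] [::] [::] (flag r) V V' C)) 3 != None).
  by rewrite Epp /=; case: (w').
have [z1 [z2 [Ez IH]]] := IHpp q1 (r || (binds a l != binds b l')).
have step u s' : exec walk
    (regs [::] (bits (rname a)) (bits (rname b)) (encpp pp) q1 X Y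
      [::] [::] (flag (binds a l || binds b l'))
      (flag (r || (binds a l != binds b l'))) V V' C) s' u ->
  exec walk (regs [::] (bits (rname a)) (bits (rname b))
      (encpp ((l, l') :: pp)) q X Y [::] [::] [::] (flag r) V V' C)
    s' (17 * ((size w).+1 + (size w').+1) + u).
  move=> W; apply: ExecLe; last first.
    apply: ExecWhileT W; first by rewrite tst.
    by rewrite Epp; apply: ExecSeq M' (ExecSeq M E).
  by lia.
rewrite sz /=; case: ifP => bb /=.
  exists (bits w' ++ Mark (is_bar l') :: bits w ++ [:: Mark (is_bar l)]), (encpp pp).
  split; first by rewrite Epp -!catA /= -!catA.
  rewrite -Eq1; apply: ExecLe; last first.
    by apply: step; rewrite bb; apply: ExecWhileF; rewrite /= andbF.
  by lia.
exists (bits w' ++ Mark (is_bar l') :: bits w ++ Mark (is_bar l) :: z1), z2.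
split; first by rewrite Epp Ez -!catA /= -!catA.
have -> : catrev (bits w' ++ Mark (is_bar l') :: bits w ++ Mark (is_bar l) :: z1) q
   = catrev z1 q1.
  by rewrite Eq1 !catrevE !(rev_cat, rev_cons) -!cats1 -!catA.
apply: ExecLe; last first.
  apply: step; rewrite bb.
  have : (binds a l != binds b l') = false by move: bb; case: binds; case: binds.
  by move=> e; rewrite e orbF in IH *; apply: IH.
by lia.
Qed.

(** Each round shortens at least one word and costs 5: a push, two pops and the test. An exhausted
    word reads as [None], so unequal lengths are detected as well. *)
Lemma exec_compare_names x y (d r : bool) T P Q X Y (E E' : seq sym)
    V (V' : seq sym) C :
  exec compare_names
    (regs T (bits x) (bits y) P Q X Y E E' (flag d) (flag r) V V' C)
    (regs T [::] [::] P Q X Y E E' [::] (flag (r || ~~ d && (x != y))) V V' C)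
    (5 * (size x + size y) + 2).
Proof.
have -> : 5 * (size x + size y) + 2 = (5 * (size x + size y) + 1) + 1 by lia.
apply: (@ExecSeq _ _ _ _ (regs T [::] [::] P Q X Y E E' (flag d)
   (flag (r || ~~ d && (x != y))) V V' C)); last first.
  by case: d; apply: exec_straight_eq.
have [n] := ubnP (size x + size y); elim: n => // n IHn in x y r *.
move: IHn; case: x => [|b x]; case: y => [|c y] IHn.
- by move=> _; rewrite andbF orbF; apply: ExecWhileF.
- rewrite /= add0n => ltn; have := IHn [::] y (r || ~~ d) ltn.
  have -> : ((r || ~~ d) || ~~ d && ([::] != y)) = r || ~~ d && true.
    by case: (r); case: (~~ d); case: (y).
  move=> H; apply: ExecLe; last first.
    apply: (exec_while_straight (n := 5 * (size (Nil bool) + size y) + 1)) => //.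
    by clear IHn; case: r d H => [] [] H; exact: H.
  by rewrite /=; lia.
- rewrite /= addSn addn0 => ltn; have := IHn x [::] (r || ~~ d).
  rewrite addn0 => /(_ ltn).
  have -> : ((r || ~~ d) || ~~ d && (x != [::])) = r || ~~ d && true.
    by case: (r); case: (~~ d); case: (x).
  move=> H; apply: ExecLe; last first.
    apply: (exec_while_straight (n := 5 * (size x) + 1)) => //.
    by clear IHn; case: r d H => [] [] H; exact: H.
  by rewrite /=; lia.
rewrite /= addSn addnS => /ltnW ltn.
have := IHn x y (r || ~~ d && (b != c)) ltn.
have -> : ((r || ~~ d && (b != c)) || ~~ d && (x != y))
  = r || ~~ d && (b :: x != c :: y).
  by rewrite eqseq_cons negb_and -orbA -andb_orr.
move=> H; apply: ExecLe; last first.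
  apply: (exec_while_straight (n := 5 * (size x + size y) + 1)) => //.
  by clear IHn; case: r d b c H => [] [] [] [] H; exact: H.
by rewrite /=; lia.
Qed.


Definition names_agree a b pp : bool :=
  ~~ (search a b pp).2 && ((search a b pp).1 || (a == b)).

(** The first pair with a binder decides: if both letters bind, the distances agree; if only one
    does, the other code is a larger distance or a free name. Without such a pair both codes are the
    names. *)
Lemma names_agreeE a b pp :
  names_agree a b pp = (code a (unzip1 pp) == code b (unzip2 pp)).
Proof.
rewrite /names_agree /code; elim: pp => [|[l l'] pp IHpp] //=.
case: (binds a l); case: (binds b l') => //=; try by case: ifP.
by rewrite {}IHpp; case: ifP; case: ifP.
Qed.

Fixpoint agree pp (x y : bar_string A) : bool :=
  match x, y with
  | l :: x', l' :: y' =>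
      names_agree (letter_name l) (letter_name l') ((l, l') :: pp)
      && agree ((l, l') :: pp) x' y'
  | _, _ => true
  end.

Lemma agreeE pp x y :
  agree pp x y = all (fun c => c.1 == c.2)
                     (zip (codes (unzip1 pp) x) (codes (unzip2 pp) y)).
Proof.
elim: x y pp => [|l x IHx] [|l' y] pp //=.
by rewrite names_agreeE IHx.
Qed.

Lemma starts_letter_encw x : starts_letter (encw x).
Proof. by case: x. Qed.

(** Loading a pair only moves symbols from the unread to the processed part, so the bound [L]
    persists. A round of loading, walking back, comparing and restoring takes at most [40 * L]
    steps. *)
Lemma exec_check_words pp x y r L V (V' : seq sym) C :
  size (encw x) + size (encw y) + size (encpp pp) <= L ->
  exists2 s', exec check_words
    (regs [::] [::] [::] (encpp pp) [::] (encw x) (encw y)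
      [::] [::] [::] (flag r) V V' C) s' (size x * (40 * L) + 1)
  & nth None (tops s') 10 = ohead (flag (r || ~~ agree pp x y)).
Proof.
elim: x y pp r => [|l x IHx] y pp r.
  eexists; first by apply: ExecWhileF.
  by rewrite orbF.
case: y => [|l' y].
  eexists; first by apply: ExecLe (ExecWhileF _ _); rewrite ?addn1.
  by rewrite orbF.
move=> leL.
pose a := letter_name l; pose b := letter_name l'; pose pp' := (l, l') :: pp.
have szpp : size (encpp pp') = size (enc l') + size (enc l) + size (encpp pp).
  by rewrite /encpp /= !size_cat !size_rev.
have leL' : size (encw x) + size (encw y) + size (encpp pp') <= L.
  by apply: leq_trans leL; rewrite szpp /enc_bar_string /= !size_cat /=; lia.
have [] := IHx y pp' (r || ~~ names_agree a b pp') leL'.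
move=> s' IH Es'; exists s'; last first.
  by rewrite Es' /= negb_and orbA.
have L1 := @exec_load false (is_bar l) (nenc a) (encw x) [::] [::] [::]
  (encpp pp) [::] (encw (l' :: y)) [::] [::] [::] (flag r) V V' C
  (starts_letter_encw x).
have L2 := @exec_load true (is_bar l') (nenc b) (encw y) [::] (bits (rname a)) [::]
  (rev (enc l) ++ encpp pp) [::] (encw x) [::] [::] [::] (flag r) V V' C
  (starts_letter_encw y).
have revE k w z : catrev (bits w) (Mark k :: z) = rev (Mark k :: bits w) ++ z.
  by rewrite catrevE rev_cons cat_rcons.
have rnameE c : catrev (bits (nenc c)) [::] = bits (rname c).
  by rewrite -/(rev _) -map_rev.
have Epp : rev (enc l') ++ rev (enc l) ++ encpp pp = encpp pp'.
  by rewrite catA.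
rewrite /= !revE !rnameE in L1 L2.
rewrite -[rev (Mark (is_bar l') :: _)]/(rev (enc l')) Epp in L2.
have [z1 [z2 [Ez W]]] := exec_walk a b pp' [::] r (encw x) (encw y) V V' C.
have Cmp := @exec_compare_names (rname a) (rname b) (search a b pp').1
  (r || (search a b pp').2) [::] z2 (catrev z1 [::]) (encw x) (encw y)
  [::] [::] V V' C.
have {}IH : exec (transfer isSome 4 [:: 3])
    (regs [::] [::] [::] z2 (catrev z1 [::]) (encw x) (encw y) [::] [::] [::]
      (flag (r || ~~ names_agree a b pp')) V V' C)
    (regs [::] [::] [::] (encpp pp') [::] (encw x) (encw y) [::] [::] [::]
      (flag (r || ~~ names_agree a b pp')) V V' C) (4 * size z1 + 1) /\
    exec check_words
    (regs [::] [::] [::] (encpp pp') [::] (encw x) (encw y) [::] [::] [::]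
      (flag (r || ~~ names_agree a b pp')) V V' C) s' (size x * (40 * L) + 1).
  split=> //; have -> : size z1 = size (catrev z1 [::]).
    by rewrite catrevE cats0 size_rev.
  apply: exec_transfer_all => //.
  by rewrite /transferred /mkseq /= !catrevE !cats0 revK Ez.
have Er : (r || (search a b pp').2)
    || ~~ (search a b pp').1 && (rname a != rname b)
   = r || ~~ names_agree a b pp'.
  rewrite /names_agree /rname (inj_eq (can_inj revK)) (inj_eq nenc_inj).
  by rewrite negb_and negbK negb_or orbA.
rewrite Er in Cmp.
case: IH => Tr IH.
apply: ExecLe; last first.
  apply: ExecWhileT IH => //.
  apply: ExecSeq L1 (ExecSeq L2 (ExecSeq W (ExecSeq Cmp Tr))).
have s1 : size z1 <= size (encpp pp') by rewrite Ez size_cat leq_addr.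
have s2 : size (encpp pp') <= L by apply: leq_trans leL'; rewrite leq_addl.
move: szpp; rewrite !size_rname !size_enc -/a -/b /=; nia.
Qed.

Lemma size_encw_ge x : size x <= size (encw x).
Proof.
elim: x => //= l x IHx; rewrite /enc_bar_string /= size_cat ltnS.
by rewrite (leq_trans IHx) ?leq_addl.
Qed.

End Checking.

(** * Unrolling the periodic parts *)

Section Unrolling.
Implicit Types (A B P Q X Y T E D R V C z q v c : seq sym).

Lemma exec_prepend (side : bool) v A B P Q X Y E (E' : seq sym) D R V C :
  let s X :=
    if side then regs [::] A B P Q Y X E E' D R V (rev v) C
    else regs [::] A B P Q X Y E E' D R (rev v) V C in
  exec (prepend (if side then 12 else 11) (if side then 6 else 5))
    (s X) (s (v ++ X)) (10 * size v + 2).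
Proof.
move=> s; rewrite /s {s}.
have -> : 10 * size v + 2 = (6 * size (rev v) + 1) + (4 * size v + 1).
  by rewrite size_rev; lia.
case: side.
  apply: (@ExecSeq _ _ _ _ (regs v A B P Q Y (v ++ X) E E' D R V [::] C)).
    apply: exec_transfer_all => //.
    by rewrite /transferred /mkseq /= !catrevE revK cats0.
  apply: exec_transfer_all => //.
apply: (@ExecSeq _ _ _ _ (regs v A B P Q (v ++ X) Y E E' D R [::] V C)).
  apply: exec_transfer_all => //.
  by rewrite /transferred /mkseq /= !catrevE revK cats0.
exact: exec_transfer_all.
Qed.

Lemma exec_unroll_loop v v' q A B P X Y E (E' : seq sym) D R C :
  exec (While (fun tp => nth None tp 4 != None)
      (Seq (Pop 4) (Seq (prepend 11 5) (prepend 12 6))))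
    (regs [::] A B P q X Y E E' D R (rev v) (rev v') C)
    (regs [::] A B P [::] (iter (size q) (cat v) X) (iter (size q) (cat v') Y)
       E E' D R (rev v) (rev v') C)
    (size q * (10 * (size v + size v') + 6) + 1).
Proof.
elim: q X Y => [|g q IHq] X Y; first by apply: ExecWhileF.
have H1 := @exec_prepend false v A B P q X Y E E' D R (rev v') C.
have H2 := @exec_prepend true v' A B P q Y (v ++ X) E E' D R (rev v) C.
apply: ExecLe; last first.
  apply: ExecWhileT; [done| |].
    apply: ExecSeq; first exact: exec_straight.
    exact: ExecSeq H1 H2.
  by rewrite [size _]/= !iterSr; apply: IHq.
by rewrite /=; lia.
Qed.

Lemma exec_unroll v v' c1 c2 A B X Y E (E' : seq sym) D R :
  exec unroll
    (regs [::] A B c1 [::] X Y E E' D R (rev v) (rev v') c2)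
    (regs [::] A B [::] [::] (iter (size c1 * size c2) (cat v) X)
      (iter (size c1 * size c2) (cat v') Y) E E' D R (rev v) (rev v') c2)
    (size c1 * (10 * size c2 + 5 + size c2 * (10 * (size v + size v') + 6)) + 1).
Proof.
elim: c1 X Y => [|g c1 IHc] X Y; first by apply: ExecWhileF.
(* The inner loop consumes its counter in register 4, so register 13 is duplicated by way of
   register 0. *)
have H1 : exec (transfer isSome 13 [:: 0])
    (regs [::] A B c1 [::] X Y E E' D R (rev v) (rev v') c2)
    (regs (rev c2) A B c1 [::] X Y E E' D R (rev v) (rev v') [::])
    (4 * size c2 + 1).
  by apply: exec_transfer_all => //.
have H2 : exec (transfer isSome 0 [:: 13; 4])
    (regs (rev c2) A B c1 [::] X Y E E' D R (rev v) (rev v') [::])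
    (regs [::] A B c1 c2 X Y E E' D R (rev v) (rev v') c2)
    (6 * size (rev c2) + 1).
  apply: exec_transfer_all => //.
  by rewrite /transferred /mkseq /= !catrevE revK cats0.
rewrite size_rev in H2.
have H3 := exec_unroll_loop v v' c2 A B c1 X Y E E' D R c2.
apply: ExecLe; last first.
  apply: ExecWhileT; [done| |].
    apply: ExecSeq; first exact: exec_straight.
    exact: ExecSeq H1 (ExecSeq H2 H3).
  by rewrite [size _]/= mulSnr !iterD; apply: IHc.
by rewrite /=; lia.
Qed.

End Unrolling.

(** * Correctness and running time of the whole procedure *)

Section Deciding.
Variables (A : eqType) (nenc : A -> seq bool).
Hypothesis nenc_inj : injective nenc.
Implicit Types (x y u v : bar_string A).

Notation encw := (enc_bar_string nenc).

Lemma encw_cat x y : encw (x ++ y) = encw x ++ encw y.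
Proof. by rewrite /enc_bar_string map_cat flatten_cat. Qed.

Lemma encw_iter m v x : encw (iter m (cat v) x) = iter m (cat (encw v)) (encw x).
Proof. by elim: m => //= m IHm; rewrite encw_cat IHm. Qed.

Lemma encw_not_sep x : all (not_sep \o Some) (encw x).
Proof.
elim: x => //= l x IHx; rewrite /enc_bar_string /= all_cat -/(encw x) IHx andbT.
by rewrite all_map; apply/allP => b.
Qed.

Definition unrolled (m : nat) (u v : bar_string A) : bar_string A :=
  u ++ iter m (cat v) [::].

(** Here [n] is the input length without separators. The first summand bounds [check_words], the
    unrolled words having total encoded length at most [n + n * n * n]; the second bounds the rounds
    of [unroll]; the rest covers reading, the last transfers and constants. *)
Definition check_bound (n : nat) : nat :=
  (n + n * n * n) * (40 * (n + n * n * n))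
  + n * (10 * n + 5 + n * (10 * n + 6)) + 12 * n + 12.

Lemma check_bound_mono m n : m <= n -> check_bound m <= check_bound n.
Proof.
move=> mn; rewrite /check_bound.
by do ![exact: mn | exact: leqnn | apply: leq_add | apply: leq_mul].
Qed.

Lemma exec_decide u v u' v' :
  let w := (encw u ++ Sep :: encw v) ++ Sep :: (encw u' ++ Sep :: encw v') in
  let n := size w - 3 in
  exists2 s', exec decide (w :: nseq 13 [::]) s' (check_bound n)
  & nth None (tops s') 10
    = ohead (flag (~~ agree [::] (unrolled (n * n) u v)
                                 (unrolled (n * n) u' v'))).
Proof.
move=> w n.
pose z1 := encw v ++ Sep :: encw u' ++ Sep :: encw v'.
pose z2 := encw u' ++ Sep :: encw v'.
have Ew : w = encw u ++ Sep :: z1.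
  by rewrite /w -catA.
(* Registers 3 and 13 collect the same symbols, of which only the number [n] matters. *)
pose c1 := rev (encw u).
pose c2 := catrev (encw v) c1.
pose c3 := catrev (encw u') c2.
pose c := catrev (encw v') c3.
have szc : size c = n.
  have szS (s : seq sym) : size (Sep :: s) = (size s).+1 by [].
  by rewrite /n Ew /c /c3 /c2 /c1 !catrevE /z1 !(size_cat, szS) !size_rev; lia.
have S1 : exec (read_word 1) (w :: nseq 13 [::])
    (regs (Sep :: z1) (rev (encw u)) [::] c1 [::] [::] [::] [::] [::] [::] [::]
      [::] [::] c1) (8 * size (encw u) + 1).
  apply: (@exec_transfer _ _ _ _ _ _ (encw u) (Sep :: z1)) => //.
  exact: encw_not_sep.
have S2 : exec (read_word 11)
    (regs z1 (rev (encw u)) [::] c1 [::] [::] [::] [::] [::] [::] [::]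
      [::] [::] c1)
    (regs (Sep :: z2) (rev (encw u)) [::] c2 [::] [::] [::] [::] [::] [::] [::]
      (rev (encw v)) [::] c2) (8 * size (encw v) + 1).
  apply: (@exec_transfer _ _ _ _ _ _ (encw v) (Sep :: z2)) => //.
  exact: encw_not_sep.
have S3 : exec (read_word 2)
    (regs z2 (rev (encw u)) [::] c2 [::] [::] [::] [::] [::] [::] [::]
      (rev (encw v)) [::] c2)
    (regs (Sep :: encw v') (rev (encw u)) (rev (encw u')) c3 [::] [::] [::]
      [::] [::] [::] [::] (rev (encw v)) [::] c3) (8 * size (encw u') + 1).
  apply: (@exec_transfer _ _ _ _ _ _ (encw u') (Sep :: encw v')) => //.
  exact: encw_not_sep.
have S4 : exec (read_word 12)
    (regs (encw v') (rev (encw u)) (rev (encw u')) c3 [::] [::] [::]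
      [::] [::] [::] [::] (rev (encw v)) [::] c3)
    (regs [::] (rev (encw u)) (rev (encw u')) c [::] [::] [::]
      [::] [::] [::] [::] (rev (encw v)) (rev (encw v')) c)
    (8 * size (encw v') + 1).
  apply: (@exec_transfer _ _ _ _ _ _ (encw v') [::]) => //.
    by rewrite cats0.
  exact: encw_not_sep.
(* The empty registers are written [encw [::]] so that [encw_iter] applies. *)
have H5 := exec_unroll (encw v) (encw v') c c (rev (encw u)) (rev (encw u'))
  (encw [::]) (encw [::]) [::] [::] [::] [::].
rewrite szc -!encw_iter in H5.
set X := encw (iter _ _ _) in H5; set Y := encw (iter _ _ _) in H5.
have H6 : exec (transfer isSome 1 [:: 5])
    (regs [::] (rev (encw u)) (rev (encw u')) [::] [::] X Y
      [::] [::] [::] [::] (rev (encw v)) (rev (encw v')) c)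
    (regs [::] [::] (rev (encw u')) [::] [::] (encw (unrolled (n * n) u v)) Y
      [::] [::] [::] [::] (rev (encw v)) (rev (encw v')) c)
    (4 * size (rev (encw u)) + 1).
  apply: exec_transfer_all => //.
  by rewrite /transferred /mkseq /= !catrevE revK -encw_cat.
have H7 : exec (transfer isSome 2 [:: 6])
    (regs [::] [::] (rev (encw u')) [::] [::] (encw (unrolled (n * n) u v)) Y
      [::] [::] [::] [::] (rev (encw v)) (rev (encw v')) c)
    (regs [::] [::] [::] [::] [::] (encw (unrolled (n * n) u v))
      (encw (unrolled (n * n) u' v'))
      [::] [::] [::] [::] (rev (encw v)) (rev (encw v')) c)
    (4 * size (rev (encw u')) + 1).
  apply: exec_transfer_all => //.
  by rewrite /transferred /mkseq /= !catrevE revK -encw_cat.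
rewrite !size_rev in H6 H7.
pose L := size (encw (unrolled (n * n) u v))
  + size (encw (unrolled (n * n) u' v')).
have [|s' H8 Es'] := @exec_check_words _ _ nenc_inj [::] (unrolled (n * n) u v)
  (unrolled (n * n) u' v') false L (rev (encw v)) (rev (encw v')) c.
  by rewrite /= addn0.
exists s' => //.
have pop0 z (s : seq (seq sym)) : exec (Pop 0) ((Sep :: z) :: s) (z :: s) 1.
  exact: ExecPop.
apply: ExecLe; last first.
  apply: ExecSeq S1 (ExecSeq (pop0 _ _) (ExecSeq S2 (ExecSeq (pop0 _ _)
    (ExecSeq S3 (ExecSeq (pop0 _ _) (ExecSeq S4 (ExecSeq H5
    (ExecSeq H6 (ExecSeq H7 H8))))))))).
have szn : size (encw u) + size (encw v) + size (encw u') + size (encw v') = n.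
  by rewrite -szc /c /c3 /c2 /c1 !catrevE !size_cat !size_rev; lia.
have szit m (a : seq sym) : size (iter m (cat a) [::]) = m * size a.
  by elim: m => //= m IHm; rewrite size_cat IHm mulSn.
have LE : L = size (encw u) + size (encw u')
    + n * n * (size (encw v) + size (encw v')).
  by rewrite /L /unrolled !encw_cat !encw_iter !size_cat !szit; lia.
have Ln : L <= n + n * n * n.
  by rewrite LE leq_add ?leq_mul // -szn; lia.
have xL : size (unrolled (n * n) u v) <= L.
  by apply: leq_trans (size_encw_ge nenc _) _; apply: leq_addr.
have XL : size (unrolled (n * n) u v) * (40 * L)
    <= (n + n * n * n) * (40 * (n + n * n * n)).
  by apply: leq_mul; [apply: leq_trans Ln | rewrite leq_mul2l Ln orbT].
have UL : n * (10 * n + 5 + n * (10 * (size (encw v) + size (encw v')) + 6))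
   <= n * (10 * n + 5 + n * (10 * n + 6)).
  by rewrite leq_mul2l leq_add2l leq_mul2l; apply/orP; right; apply/orP; right; lia.
rewrite /check_bound.
move: XL UL; lia.
Qed.

Lemma size_enc_up_pair (p : up_pair A) :
  size (up_u p) + size (up_v p) < size (enc_up_pair nenc p).
Proof.
rewrite /enc_up_pair; move: (up_v p) => v; rewrite size_cat /= addnS ltnS.
by apply: leq_add; apply: size_encw_ge.
Qed.

(** Each letter contributes at least its mark; the 3 stands for the separators. *)
Lemma size_words_le (p q : up_pair A) :
  size (up_u p) + size (up_v p) + size (up_u q) + size (up_v q)
  <= size (enc_up_pairs nenc (p, q)) - 3.
Proof.
have -> : size (enc_up_pairs nenc (p, q))
    = size (enc_up_pair nenc p) + (size (enc_up_pair nenc q)).+1.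
  by rewrite /enc_up_pairs size_cat.
by have := size_enc_up_pair p; have := size_enc_up_pair q; lia.
Qed.

Lemma size_unrolled m u v : size (unrolled m u v) = size u + m * size v.
Proof.
rewrite size_cat; congr (_ + _).
by elim: m => //= m IHm; rewrite size_cat IHm.
Qed.

Lemma unrolledE m (p : up_pair A) :
  unrolled m (up_u p) (up_v p)
  = mkseq (up_word p) (size (up_u p) + m * size (up_v p)).
Proof.
apply: (@eq_from_nth _ (up_vhead p)); first by rewrite size_mkseq size_unrolled.
move=> i; rewrite size_unrolled => si.
rewrite nth_mkseq // /up_word nth_cat; case: ltnP => // ui.
have : i - size (up_u p) < m * size (up_v p).
  by lia.
elim: m (i - _) {si} => // m IHm j jm; rewrite iterS nth_cat.
case: ltnP => jv; first by rewrite modn_small.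
rewrite IHm; last by rewrite mulSn in jm; lia.
by rewrite -[X in _ = nth _ _ (X %% _)](subnK jv) modnDr.
Qed.

Lemma agree_mkseq (f g : inf_bar_string A) m n :
  agree [::] (mkseq f m) (mkseq g n) <->
  (forall i, i < minn m n -> code_at f i = code_at g i).
Proof.
rewrite agreeE !codes_mkseq.
have sz : size (zip (mkseq (code_at f) m) (mkseq (code_at g) n)) = minn m n.
  by rewrite size_zip !size_mkseq.
pose d := (inl 0 : nat + A).
have nthE i : i < minn m n ->
    nth (d, d) (zip (mkseq (code_at f) m) (mkseq (code_at g) n)) i
    = (code_at f i, code_at g i).
  move=> im; rewrite nth_zip_cond sz im !nth_mkseq //;
    by move: im; rewrite leq_min => /andP[].
split=> [/(all_nthP (d, d)) H i im|H].
  by have := H i; rewrite sz nthE // => /(_ im)/eqP.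
by apply/(all_nthP (d, d)) => i; rewrite sz => im; rewrite nthE //= H.
Qed.

(** Since both periodic parts are nonempty and [n] is at least the sum of the four lengths, [n * n]
    copies of either one reach the bound of [code_at_up_word]. *)
Lemma agree_unrolled (p q : up_pair A) n :
  (forall s : seq A, exists a : A, a \notin s) ->
  size (up_u p) + size (up_v p) + size (up_u q) + size (up_v q) <= n ->
  agree [::] (unrolled (n * n) (up_u p) (up_v p))
             (unrolled (n * n) (up_u q) (up_v q)) <->
  alpha_eq_inf (up_word p) (up_word q).
Proof.
move=> fresh nge; rewrite (alpha_eq_infP fresh) !(unrolledE (n * n)) agree_mkseq.
split=> [|H i _]; last exact: H.
apply: code_at_up_word; rewrite leq_min.
have vp : 0 < size (up_v p) by []. have vq : 0 < size (up_v q) by [].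
by apply/andP; split; nia.
Qed.

End Deciding.

Theorem corollary4p6 (A : countType)
  (A_infinite : forall s : seq A, exists a : A, a \notin s)
  (nenc : A -> seq bool) (nenc_inj : injective nenc) :
  decidable_in_polynomial_time (@enc_up_pairs A nenc)
    (fun x : up_pair A * up_pair A =>
       alpha_eq_inf (up_word x.1) (up_word x.2)).
Proof.
pose c m : {poly nat} := (m%:P)%R.
pose X3 : {poly nat} := ('X + 'X * 'X * 'X)%R.
(* This is [check_bound] plus one; the additional step outputs the answer. *)
pose P : {poly nat} := (X3 * (c 40 * X3)
  + 'X * (c 10 * 'X + c 5 + 'X * (c 10 * 'X + c 6)) + c 12 * 'X + c 13)%R.
(* There are 14 tapes, and the answer is positive iff flag 10 is down. *)
exists (tm_of_prog 13 decide (fun tp => nth None tp 10 == None)), P => -[p q] /=.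
set w := enc_up_pairs nenc (p, q); pose n := size w - 3.
have EP m : P.[m]%R = (check_bound m).+1.
  rewrite /P /X3 /c !(hornerD, hornerM, hornerX, hornerC) /check_bound.
  by rewrite -[RHS]addnS.
exists (agree [::] (unrolled (n * n) (up_u p) (up_v p))
  (unrolled (n * n) (up_u q) (up_v q))).
split; last first.
  by apply: agree_unrolled => //; apply: size_words_le.
have [s' Hs' E] := exec_decide nenc_inj (up_u p) (up_v p) (up_u q) (up_v q).
have := @tm_of_prog_correct _ 13 _ (fun tp => nth None tp 10 == None) _ _ _ Hs'.
rewrite EP E; set b := agree _ _ _.
have -> : (ohead (flag (~~ b)) == None) = b by case: b.
(* The run is bounded in terms of [n], while the polynomial is evaluated at the full length of [w];
   a given answer persists. *)
by apply: tm_answer_mono; rewrite ltnS check_bound_mono // leq_subr.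
Qed.
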